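(* (i) For integers $k\ge 3$ and $n\ge 4k-3$, $\mathrm{sat}(n,k\mathcal{C}_{\ge3})\le n+6k-7$. (ii) For integers $k\ge 5$ and $n\ge 4k^2-21k+37$, $$[n+6k-7,\,(2k-5)n-6k^2+21k-3]\subset \mathrm{ES}(n,k\mathcal{C}_{\ge3}).$$
   Context: All graphs are finite and simple. For integers $a\le b$, $[a,b]=\{a,\dots,b\}$. For a family $\mathcal{H}$ of graphs, a graph $G$ is $\mathcal{H}$-saturated if $G$ contains no subgraph isomorphic to a member of $\mathcal{H}$, but for every pair of non-adjacent vertices $u,v$ the graph $G+uv$ contains a subgraph isomorphic to some member of $\mathcal{H}$. $\mathrm{sat}(n,\mathcal{H})$ is the minimum number of edges of an $n$-vertex $\mathcal{H}$-saturated graph, and $\mathrm{ES}(n,\mathcal{H})$ is the set of numbers of edges of all $n$-vertex $\mathcal{H}$-saturated graphs. $k\mathcal{C}_{\ge3}$ is the family of all vertex-disjoint unions of $k$ (not necessarily distinct) cycles of length at least $3$. *)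

(* Defs.v *)
From HB Require Import structures.
From mathcomp Require Import all_boot all_order all_algebra.

Set Implicit Arguments.
Unset Strict Implicit.
Unset Printing Implicit Defensive.

Record sgraph := SGraph {
  vertex :> finType;
  adj : rel vertex;
  adj_sym : symmetric adj;
  adj_irr : irreflexive adj
}.

Definition edges (G : sgraph) : {set {set G}} :=
  [set [set p.1; p.2] | p : G * G & adj p.1 p.2].

(* G has a (not necessarily induced) subgraph isomorphic to H. *)
Definition contains (G H : sgraph) : Prop :=
  exists2 f : H -> G,
    injective f & forall x y : H, adj x y -> adj (f x) (f y).

Definition isomorphic (G H : sgraph) : Prop :=
  exists2 f : G -> H,
    bijective f & forall x y : G, adj (f x) (f y) = adj x y.

Section AddEdge.
Variables (G : sgraph) (u v : G).

Definition add_edge_rel : rel G := fun x y =>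
  adj x y || (x != y) && ((x == u) && (y == v) || (x == v) && (y == u)).

Lemma add_edge_sym : symmetric add_edge_rel.
Proof.
move=> x y; rewrite /add_edge_rel adj_sym eq_sym; congr (_ || _ && _).
by rewrite orbC andbC [in X in _ || X]andbC.
Qed.

Lemma add_edge_irr : irreflexive add_edge_rel.
Proof. by move=> x; rewrite /add_edge_rel adj_irr eqxx. Qed.

(* G + uv when u != v; the graph is unchanged when u = v. *)
Definition add_edge : sgraph := SGraph add_edge_sym add_edge_irr.
End AddEdge.

Section CycleGraph.
Variable l : nat.

Definition cycle_rel : rel 'I_l := fun i j =>
  (i != j) && ((ordS i == j) || (ordS j == i)).

Lemma cycle_sym : symmetric cycle_rel.
Proof. by move=> i j; rewrite /cycle_rel eq_sym orbC. Qed.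

Lemma cycle_irr : irreflexive cycle_rel.
Proof. by move=> i; rewrite /cycle_rel eqxx. Qed.

(* The cycle of length l when l >= 3. *)
Definition cycle_graph : sgraph := SGraph cycle_sym cycle_irr.
End CycleGraph.

Section DisjointUnion.
Variables (I : finType) (G : I -> sgraph).

Definition dunion_rel : rel {i : I & G i} := fun x y =>
  (tag x == tag y) && adj (tagged x) (tagged_as x y).

Lemma dunion_sym : symmetric dunion_rel.
Proof.
move=> [i x] [j y]; rewrite /dunion_rel /= [j == i]eq_sym.
by case: eqP => // eq_ij; case: j / eq_ij y => y; rewrite !tagged_asE adj_sym.
Qed.

Lemma dunion_irr : irreflexive dunion_rel.
Proof. by move=> [i x]; rewrite /dunion_rel tagged_asE adj_irr andbF. Qed.

Definition dunion : sgraph := SGraph dunion_sym dunion_irr.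
End DisjointUnion.

Definition graph_family := sgraph -> Prop.

Definition contains_member (F : graph_family) (G : sgraph) : Prop :=
  exists2 H : sgraph, F H & contains G H.

Definition saturated (F : graph_family) (G : sgraph) : Prop :=
  ~ contains_member F G /\
  forall u v : G, u != v -> ~~ adj u v -> contains_member F (add_edge u v).

Definition ES (n : nat) (F : graph_family) (m : nat) : Prop :=
  exists G : sgraph, [/\ #|G| = n, saturated F G & #|edges G| = m].

(* sat(n, F) = s.  A relation rather than a function, so that no value is
   attributed to sat(n, F) if there is no F-saturated graph on n vertices. *)
Definition is_sat (n : nat) (F : graph_family) (s : nat) : Prop :=
  ES n F s /\ forall m : nat, ES n F m -> s <= m.

Definition kcycles (k : nat) : graph_family := fun H =>
  exists2 l : 'I_k -> nat,
    forall i, 3 <= l i &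
    isomorphic H (dunion (fun i => cycle_graph (l i))).

(* Main.v *)
(* Glue blocks at a common vertex, the apex.  A block (r, i) consists of a clique
   of 2r+1 vertices (its core) completely joined to i independent vertices; the
   apex is joined to the core, and to the whole block when i <= 1.  For i > r and
   i > 1, and for (1, 1) (giving a K_5) and (0, 0) (giving a pendant edge), every
   cycle meeting the block uses two of its 2r+1 core vertices, or, when i <= 1,
   three of the 3r+2 vertices of the block and the apex; so at most r disjoint
   cycles meet it, and the whole graph has at most the sum of the r's, k-1.
   Conversely a new edge closes a cycle through the apex or inside one block after
   which every block, with the apex if it is unused, still packs r triangles.
   A block other than (0, 0) adds to the n-1 edges of a star an excess of
   r(2r+1) + 2ri, or 6 for (1, 1).  Blocks (1, 1) and (1, i), i >= 2, have excess
   6 and 7, 9, 11, ..., so two of them realise every excess from 12 on; together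
   with one large block (k-3, i), of step 2(k-3) in i, they sweep the interval. *)

Require Import Defs.
From Stdlib Require Import Classical_Prop.
From mathcomp Require Import all_boot all_order all_algebra.
From mathcomp Require Import zify.

Set Implicit Arguments.
Unset Strict Implicit.
Unset Printing Implicit Defensive.

(** * Packings of disjoint cycles, as sequences of vertices *)

Definition is_cycle (G : sgraph) (s : seq G) : bool :=
  (2 < size s) && cycle (@adj G) s.

(* [uniq (flatten ss)] makes the cycles both simple and pairwise disjoint. *)
Definition packs (G : sgraph) (Y : {set G}) (r : nat) : Prop :=
  exists ss : seq (seq G),
    [/\ size ss = r, all (@is_cycle G) ss, uniq (flatten ss)
      & {subset flatten ss <= Y}].

Lemma packs_sub (G : sgraph) (Y Z : {set G}) r :
  Y \subset Z -> packs Y r -> packs Z r.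
Proof.
move=> /subsetP sYZ [ss [szs cs us ssY]]; exists ss; split=> // x xss.
exact/sYZ/ssY.
Qed.

Lemma packs0 (G : sgraph) (Y : {set G}) : packs Y 0.
Proof. by exists [::]. Qed.

Lemma packs1 (G : sgraph) (s : seq G) :
  is_cycle s -> uniq s -> packs [set x in s] 1.
Proof.
move=> cs us; exists [:: s]; split=> //=; first by rewrite cs.
  by rewrite cats0.
by move=> x; rewrite cats0 inE.
Qed.

Lemma packsU (G : sgraph) (Y Z : {set G}) r s :
  [disjoint Y & Z] -> packs Y r -> packs Z s -> packs (Y :|: Z) (r + s).
Proof.
move=> dYZ [ss [<- css uss ssY]] [tt [<- ctt utt ttZ]]; exists (ss ++ tt).
rewrite size_cat all_cat css ctt flatten_cat; split=> // [|x]; last first.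
  by rewrite mem_cat inE => /orP[/ssY->|/ttZ->]; rewrite ?orbT.
rewrite cat_uniq uss utt andbT /=.
apply/hasPn => x /ttZ xZ; apply/negP => /ssY xY.
by have := disjointFr dYZ xY; rewrite xZ.
Qed.

Lemma packs_bigcup (G : sgraph) (I : finType) (Y : I -> {set G}) (r : I -> nat) :
  (forall i j, i != j -> [disjoint Y i & Y j]) ->
  (forall i, packs (Y i) (r i)) -> packs (\bigcup_i Y i) (\sum_i r i).
Proof.
move=> dY pY; rewrite -big_enum -[X in packs _ X]big_enum /=.
have := enum_uniq I; elim: (enum I) => [|i s IHs] /=.
  by move=> _; rewrite !big_nil; apply: packs0.
case/andP=> /negP nis us; rewrite !big_cons; apply: packsU => //; last exact: IHs.
rewrite disjoint_sym; apply/pred0P => x /=; apply/negP => /andP[].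
elim: s nis {us IHs} => [|j s IHs] nis; first by rewrite big_nil inE.
rewrite big_cons inE => /orP[xj xi|]; last first.
  by apply: IHs => iS; apply: nis; rewrite inE iS orbT.
have nij : i != j by apply: contra_notN nis => /eqP->; rewrite mem_head.
by have := disjointFr (dY _ _ nij) xi; rewrite xj.
Qed.

Lemma packs_add_edge (G : sgraph) (u v : G) (Y : {set G}) r :
  packs Y r -> @packs (add_edge u v) Y r.
Proof.
move=> [ss [szs cs us ssY]]; exists ss; split=> //.
apply: sub_all cs => s /andP[sz cy]; rewrite /is_cycle sz /=.
case: s cy {sz} => //= x s; apply: sub_path => y z.
by rewrite /= /add_edge_rel => ->.
Qed.

(** Greedy choice: [Q] dominates [Y], so two vertices of [Q] and any third vertex of [Y] form a
    triangle. *)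
Lemma packs_triangles (G : sgraph) (Q Y : {set G}) r :
  Q \subset Y -> {in Q & Y, forall q y, q != y -> adj q y} ->
  r.*2 <= #|Q| -> 3 * r <= #|Y| -> packs Y r.
Proof.
elim: r Q Y => [|r IHr] Q Y sQY adjQ leQ leY; first exact: packs0.
have /card_gt1P [a [b [aQ bQ nab]]] : 1 < #|Q| by lia.
have aY := subsetP sQY _ aQ; have bY := subsetP sQY _ bQ.
have [c [cY nac nbc leQ']] : exists c, [/\ c \in Y, a != c, b != c
    & r.*2 <= #|Q :\ a :\ b :\ c|].
  have Qab : #|Q :\ a :\ b| = #|Q| - 2.
    have := cardsD1 b (Q :\ a); have := cardsD1 a Q.
    by rewrite !inE aQ bQ eq_sym nab /=; clear; lia.
  (* The third vertex is taken outside [Q] if possible, to spend only two vertices of [Q]. Otherwise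
     [Q = Y] has at least [3(r+1)] vertices and can afford three. *)
  have [sYQ|/subsetPn[c cY ncQ]] := boolP (Y \subset Q).
    have QY : Q = Y by apply/eqP; rewrite eqEsubset sQY.
    have /card_gt0P [c] : 0 < #|Q :\ a :\ b| by rewrite Qab QY; lia.
    rewrite !inE => /and3P[ncb nca cQ]; exists c.
    split; rewrite // 1?eq_sym ?QY -?QY //.
    have := cardsD1 c (Q :\ a :\ b); rewrite !inE ncb nca cQ Qab QY.
    by move: leY; clear; lia.
  exists c; split=> //; try by apply: contraNneq ncQ => <-.
  have := cardsD1 c (Q :\ a :\ b); rewrite !inE (negPf ncQ) !andbF add0n => <-.
  by rewrite Qab; move: leQ; clear; lia.
have cabc : is_cycle [:: a; b; c].
  rewrite /is_cycle /= andbT adjQ //= adjQ //=.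
  by rewrite adj_sym adjQ.
have uabc : uniq [:: a; b; c] by rewrite /= !inE negb_or nab nac nbc.
have Y3 : #|Y :\ a :\ b :\ c| = #|Y| - 3.
  have := cardsD1 c (Y :\ a :\ b).
  have := cardsD1 b (Y :\ a); have := cardsD1 a Y.
  rewrite !inE aY bY cY [b == a]eq_sym [c == a]eq_sym [c == b]eq_sym nab nac nbc /=.
  by clear; lia.
rewrite -add1n; apply: (@packs_sub G ([set x in [:: a; b; c]] :|: (Y :\ a :\ b :\ c))).
  apply/subsetP => x; rewrite !inE.
  by move=> /orP[/or3P[]/eqP-> //|/and4P[]].
apply: packsU; last 1 first.
- apply: (IHr (Q :\ a :\ b :\ c)) => //; last by rewrite Y3; move: leY; clear; lia.
    by rewrite !setSD.
  move=> x y; rewrite !inE => /and4P[_ _ _ xQ] /and4P[_ _ _ yY]; exact: adjQ.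
- apply/pred0P => x /=; rewrite !inE.
  by case: (x == a); case: (x == b); case: (x == c).
exact: packs1.
Qed.

(** * Packings versus subgraphs that are unions of [k] disjoint cycles *)

Lemma uniq_mem_flatten (T : eqType) (ss : seq (seq T)) s :
  uniq (flatten ss) -> s \in ss -> uniq s.
Proof.
elim: ss => //= t tt IH; rewrite cat_uniq => /and3P[ut _ utt].
by rewrite inE => /orP[/eqP-> //|/(IH utt)].
Qed.

Lemma uniq_nth_flatten (T : eqType) (ss : seq (seq T)) x i j :
  uniq (flatten ss) -> x \in nth [::] ss i -> x \in nth [::] ss j -> i = j.
Proof.
have memF s i' : x \in nth [::] s i' -> x \in flatten s.
  move=> xi; apply/flattenP; exists (nth [::] s i') => //.
  by apply: mem_nth; rewrite ltnNge; apply/negP => /(nth_default [::]) E; rewrite E in xi.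
elim: ss i j => [|s ss IHs] [|i] [|j] //=; rewrite cat_uniq => /and3P[us /hasPn ns uss].
- by move=> xs /memF /ns /=; rewrite xs.
- by move=> /memF /ns /= /negP h /h.
by move=> xi xj; congr _.+1; apply: IHs xi xj.
Qed.

Lemma cycle_nth (T : Type) (e : rel T) (x0 : T) (s : seq T) i :
  cycle e s -> i < size s -> e (nth x0 s i) (nth x0 s (i.+1 %% size s)).
Proof.
case: s => //= x s /(pathP x0) /(_ i); rewrite size_rcons => /[swap] lti /(_ lti).
rewrite -rcons_cons nth_rcons /= lti nth_rcons.
move: lti; rewrite ltnS leq_eqVlt => /orP[/eqP->|lti].
  by rewrite ltnn eqxx modnn.
by rewrite lti modn_small.
Qed.

Lemma packs_contains (G : sgraph) (x0 : G) k :
  packs [set: G] k -> contains_member (kcycles k) G.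
Proof.
move=> [ss [szs /all_nthP-/(_ [::]) cs us _]].
pose l (i : 'I_k) := size (nth [::] ss i).
have cyc (i : 'I_k) : is_cycle (nth [::] ss i) by apply: cs; rewrite szs.
exists (dunion (fun i => cycle_graph (l i))).
  exists l; first by move=> i; case/andP: (cyc i).
  by exists id => //; exists id.
exists (fun x : {i : 'I_k & 'I_(l i)} => nth x0 (nth [::] ss (tag x)) (tagged x)).
  move=> [i a] [j b] /= E.
  have ij : i = j.
    apply/val_inj/(uniq_nth_flatten us (mem_nth x0 (ltn_ord a))).
    by rewrite E; apply/mem_nth/(ltn_ord b).
  case: j / ij b E => b /eqP; rewrite nth_uniq //; first by move/eqP/val_inj->.
  by apply: uniq_mem_flatten us _; apply: mem_nth; rewrite szs.
move=> [i a] [j b] /andP[/= /eqP ij]; case: j / ij b => b.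
rewrite tagged_asE => /andP[_ ]; case/andP: (cyc i) => _ cyi.
have step (c : 'I_(l i)) :
    adj (nth x0 (nth [::] ss i) c) (nth x0 (nth [::] ss i) (ordS c)).
  exact: cycle_nth.
by case/orP=> /eqP <-; last rewrite adj_sym; apply: step.
Qed.

(** The converse keeps only what the upper bound on the number of cycles needs: in the vertex set of
    a cycle every vertex has two neighbours. *)
Lemma contains_dense (G : sgraph) k : contains_member (kcycles k) G ->
  exists S : 'I_k -> {set G},
    [/\ forall i, S i != set0,
        forall i j, i != j -> [disjoint S i & S j]
      & forall i, {in S i, forall v, 1 < #|[set y in S i | adj v y]|}].
Proof.
move=> [H [l l3 [g [g' gK g'K] gadj]] [f finj fadj]].
pose h i (j : 'I_(l i)) : G := f (g' (Tagged (fun i => 'I_(l i)) j)).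
have hadj i (a b : 'I_(l i)) : cycle_rel a b -> adj (h i a) (h i b).
  move=> ab; apply: fadj; rewrite -gadj !g'K /= /dunion_rel /= eqxx.
  by rewrite tagged_asE.
have hinj i a j b : h i a = h j b ->
    Tagged (fun i => 'I_(l i)) a = Tagged (fun i => 'I_(l i)) b.
  by move/finj/(can_inj g'K).
have hinji i : injective (h i).
  by move=> a b /hinj /eqP; rewrite eq_Tagged => /eqP.
exists (fun i => h i @: setT); split.
- move=> i; apply/set0Pn; exists (h i (Ordinal (ltn_trans (isT : 0 < 2) (l3 i)))).
  exact: imset_f.
- move=> i j nij; apply/pred0P => x /=; apply/negP.
  move=> /andP[/imsetP[a _ ->] /imsetP[b _ /hinj /(congr1 tag) /= ij]].
  by rewrite ij eqxx in nij.
move=> i _ /imsetP[a _ ->]; apply/card_gt1P.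
have nS (c : 'I_(l i)) : c != ordS c.
  apply/eqP => /(congr1 val) /=; have := ltn_ord c; have := l3 i.
  move: (val c) => m l3i; rewrite leq_eqVlt => /orP[/eqP E|lt]; last first.
    by rewrite modn_small //; lia.
  by rewrite E modnn; lia.
exists (h i (ordS a)), (h i (ord_pred a)); split.
- rewrite inE imset_f //=; apply: hadj; by rewrite /cycle_rel nS eqxx.
- rewrite inE imset_f //=; apply: hadj.
  by rewrite /cycle_rel ord_predK eqxx orbT andbT -{1}(ord_predK a) eq_sym nS.
(* If successor and predecessor coincided, two steps round the cycle would return to [a], which a
   length of at least 3 forbids. *)
apply/eqP => /hinji E.
have : ordS (ordS a) = a by rewrite E ord_predK.
move/(congr1 val) => /=; have := ltn_ord a; have := l3 i.
move: (val a) => m l3i.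
have -> : (m.+1 %% l i).+1 %% l i = m.+2 %% l i.
  by rewrite -addn1 modnDml addn1.
move=> ltm; case: (ltnP m.+2 (l i)) => lt2.
  by rewrite modn_small //; lia.
have -> : m.+2 = (m.+2 - l i) + l i by lia.
by rewrite modnDr modn_small; lia.
Qed.

(** Double counting of the pairs [(i, x)] with [x] in [S i :&: A]: each [x] lies in at most one
    [S i]. *)
Lemma disjoint_card (T I : finType) (S : I -> {set T}) (P : pred I) (A : {set T}) c :
  (forall i j, i != j -> [disjoint S i & S j]) ->
  (forall i, P i -> c <= #|S i :&: A|) -> c * #|P| <= #|A|.
Proof.
move=> dS cS; rewrite mulnC -sum_nat_const.
apply: (@leq_trans (\sum_(i in P) \sum_(x in A) (x \in S i))).
  apply: leq_sum => i Pi; apply: leq_trans (cS i Pi) _.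
  by rewrite -sum1_card big_mkcond [X in _ <= X]big_mkcond leq_sum // => x _;
    rewrite inE; case: (x \in S i); case: (x \in A).
rewrite exchange_big /= -sum1_card; apply: leq_sum => x _.
rewrite -big_mkcondr /= sum1_card; apply/card_le1_eqP => i j.
move=> /andP[_ xi] /andP[_ xj]; apply/eqP.
by apply: contraTT xj => /dS dij; rewrite (disjointFl dij xi).
Qed.

(** * Blocks glued at an apex *)

(** The first disjunct admits exactly [(0, 0)] and [(1, 1)]. In the second, [i > 1] keeps the apex
    away from the independent vertices, and [i > r] leaves room for [r] triangles after two vertices
    are lost. *)
Definition good_block (p : nat * nat) : bool :=
  ((p.1 == p.2) && (p.2 <= 1)) || (maxn 1 p.1 < p.2).

Section BlockGraph.
Variable bl : seq (nat * nat).

Definition rk (b : 'I_(size bl)) : nat := (nth (0, 0) bl b).1.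
Definition ext (b : 'I_(size bl)) : nat := (nth (0, 0) bl b).2.
Definition core_size (b : 'I_(size bl)) : nat := (rk b).*2.+1.

Definition bvertex : finType :=
  {b : 'I_(size bl) & 'I_(core_size b + ext b)}.

Definition in_core (x : bvertex) : bool := tagged x < core_size (tag x).
Definition near_apex (x : bvertex) : bool := in_core x || (ext (tag x) <= 1).

(* [None] is the apex. *)
Definition block_rel : rel (option bvertex) := fun x y =>
  match x, y with
  | None, None => false
  | None, Some v | Some v, None => near_apex v
  | Some u, Some v => [&& tag u == tag v, u != v & in_core u || in_core v]
  end.

Lemma block_sym : symmetric block_rel.
Proof.
move=> [x|] [y|] //=.
by rewrite [tag y == _]eq_sym [y == x]eq_sym [in_core y || _]orbC.
Qed.

Lemma block_irr : irreflexive block_rel.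
Proof. by move=> [x|] //=; rewrite !eqxx. Qed.

Definition block_graph : sgraph := SGraph block_sym block_irr.

Definition block (b : 'I_(size bl)) : {set block_graph} :=
  [set x : option bvertex | if x is Some v then tag v == b else false].
Definition core (b : 'I_(size bl)) : {set block_graph} :=
  [set x : option bvertex |
     if x is Some v then (tag v == b) && in_core v else false].

Lemma core_sub b : core b \subset block b.
Proof. by apply/subsetP => -[x|]; rewrite !inE //= => /andP[]. Qed.

Lemma card_block b : #|block b| = core_size b + ext b.
Proof.
rewrite -[RHS]card_ord -cardsT.
rewrite -(@card_imset _ _ (fun j : 'I_(core_size b + ext b) =>
  Some (Tagged (fun b => 'I_(core_size b + ext b)) j) : option bvertex)); last first.
  by move=> i j /Some_inj /eqP; rewrite eq_Tagged => /eqP.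
apply: eq_card => -[[c j]|]; rewrite !inE /=; last first.
  by apply/esym/negP => /imsetP[].
apply/eqP/imsetP => [E|[j' _ [] //]].
by rewrite /= in E; case: b / E; exists j.
Qed.

Lemma card_core b : #|core b| = core_size b.
Proof.
rewrite -[RHS]card_ord -cardsT.
rewrite -(@card_imset _ _ (fun j : 'I_(core_size b) =>
  Some (Tagged (fun b => 'I_(core_size b + ext b)) (lshift _ j)) : option bvertex)); last first.
  by move=> i j /Some_inj /eqP; rewrite eq_Tagged => /eqP /lshift_inj.
apply: eq_card => -[[c j]|]; rewrite !inE /in_core /=; last first.
  by apply/esym/negP => /imsetP[].
apply/andP/imsetP => [[/eqP E lt]|[j' _ /Some_inj E]].
  rewrite /= in E; case: b / E; exists (Ordinal lt) => //.
  by congr (Some (Tagged _ _)); apply: val_inj.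
have /= cb := congr1 tag E; case: b / cb j' E => j' /eqP.
rewrite eq_Tagged /= => /eqP->.
by rewrite /= ltn_ord.
Qed.

Lemma block_disj b c : b != c -> [disjoint block b & block c].
Proof.
move=> nbc; apply/pred0P => -[x|] /=; rewrite !inE //.
by apply/negP => /andP[/eqP-> /eqP E]; rewrite E eqxx in nbc.
Qed.

(** * No [k] disjoint cycles *)

Hypothesis good : all good_block bl.

Lemma good_rk b :
  (rk b == ext b) && (ext b <= 1) || (maxn 1 (rk b) < ext b).
Proof. exact: (all_nthP (0, 0) good _ (ltn_ord b)). Qed.

(** For [ext b <= 1], a vertex of [S] in the block has all its neighbours in the block or at the
    apex, which gives three vertices. For [ext b > 1], a vertex of [S] off the core has only core
    neighbours; if there is none, [S] meets the block inside the core. *)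
Lemma dense_block (S : {set block_graph}) b :
  {in S, forall v, 1 < #|[set y in S | adj v y]|} ->
  ~~ [disjoint S & block b] ->
  if ext b <= 1 then 2 < #|S :&: (None |: block b)| else 1 < #|S :&: core b|.
Proof.
move=> dS /pred0Pn [[x|] /= /andP[xS]]; rewrite inE // => /eqP xb.
case: ifP => extb.
  have /card_gt1P [y [z [yN zN nyz]]] := dS _ xS.
  have nbr (t : block_graph) : t \in [set y in S | adj (Some x : block_graph) y] ->
      [/\ t \in S, t \in None |: block b & t != Some x].
    rewrite inE => /andP[tS]; case: t tS => [t|] tS; rewrite !inE //=.
    move=> /and3P[/eqP xt nxt _]; split=> //; first by rewrite -xb xt eqxx.
    by apply: contraNneq nxt => -[->].
  have [yS yb nyx] := nbr _ yN; have [zS zb nzx] := nbr _ zN.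
  apply/card_gt2P; exists (Some x), y, z; split; last by split=> //; rewrite eq_sym.
  by split; rewrite in_setI ?xS ?yS ?zS //= !inE xb eqxx.
have core_nbr (t y : block_graph) : t \in block b -> t \notin core b ->
    adj t y -> y \in core b.
  case: t => [t|]; rewrite !inE //= => /eqP tb; rewrite tb eqxx /= => ntc.
  case: y => [y|]; rewrite ?inE /=; last by rewrite /near_apex tb extb (negPf ntc).
  by rewrite (negPf ntc) eq_sym /= => /and3P[-> _ ->].
have [[u /and3P[uS ub uc]]|noext] :=
    classic (exists u, [&& u \in S, u \in block b & u \notin core b]).
  apply: leq_trans (dS _ uS) _; apply/subset_leq_card/subsetP => y.
  by rewrite !inE => /andP[-> /(core_nbr _ _ ub uc)]; rewrite inE.
have blockS (t : block_graph) : t \in S -> t \in block b -> t \in core b.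
  by move=> tS tb; apply/negPn/negP => tc; apply: noext; exists t; rewrite tS tb.
have xblock : (Some x : block_graph) \in block b by rewrite inE xb.
have /card_gt1P [y [z [yN zN nyz]]] := dS _ xS.
apply/card_gt1P; exists (Some x).
(* Of two distinct neighbours of [x], at most one is the apex; the other is a second core vertex. *)
have [t [tS tx]] : exists t : bvertex, (Some t : block_graph) \in S /\
    adj (Some x : block_graph) (Some t).
  move: yN zN nyz; rewrite !inE.
  case: y => [y|]; first by move=> /andP[*]; exists y.
  by case: z => [z|] //; move=> _ /andP[*]; exists z.
exists (Some t); move: (tx) => /= /and3P[/eqP xt nxt _].
split; first by rewrite inE xS blockS.
- by rewrite inE tS blockS // inE -xt xb.
- by [].
Qed.

(** Each cycle is charged to a block it meets; one exists, since the apex has neighbours only in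
    blocks. If [q] cycles are charged to a block of rank [r], then [3q <= 3r+2] or [2q <= 2r+1], so
    [q <= r]. *)
Lemma block_graph_free : ~ contains_member (kcycles (\sum_b rk b).+1) block_graph.
Proof.
move/contains_dense => [S [S0 dS degS]].
have meets i : exists b, ~~ [disjoint S i & block b].
  have /set0Pn [x xS] := S0 i.
  have [y yS] : exists y : bvertex, (Some y : block_graph) \in S i.
    case: x xS => [x|] xS; first by exists x.
    have /card_gt1P [y [z [yN zN nyz]]] := degS i _ xS.
    move: yN zN nyz; rewrite !inE.
    case: y => [y|]; first by move=> /andP[*]; exists y.
    by case: z => [z|] //; move=> _ /andP[*]; exists z.
  by exists (tag y); apply/pred0Pn; exists (Some y); rewrite /= yS inE eqxx.
have [B mB] := fin_all_exists meets.
suff leB b : #|[pred i | B i == b]| <= rk b.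
  have : \sum_b #|[pred i | B i == b]| <= \sum_b rk b by apply: leq_sum.
  suff -> : \sum_b #|[pred i | B i == b]| = (\sum_b rk b).+1 by rewrite ltnn.
  rewrite -[RHS]card_ord -sum1_card (partition_big B xpredT) //=.
  by apply: eq_bigr => b _; rewrite sum1_card.
have dense i : B i == b ->
    if ext b <= 1 then 2 < #|S i :&: (None |: block b)| else 1 < #|S i :&: core b|.
  by move/eqP => E; apply: dense_block (degS i) _; rewrite -E.
have := good_rk b; have := card_core b; have := card_block b; rewrite /core_size.
have [extb cb _ gb|extb _ cc gb] := leqP (ext b) 1.
  have := @disjoint_card _ _ S [pred i | B i == b] (None |: block b) 3 dS.
  rewrite cardsU1 cb inE /= => leS.
  have {leS} : 3 * #|[pred i | B i == b]| <= 1 + ((rk b).*2.+1 + ext b).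
    by apply: leS => i /dense; rewrite extb.
  case/orP: gb => [/andP[/eqP-> _]|]; move: extb; clear.
    by move: (#|_|) (ext b); lia.
  by move: (#|_|) (rk b) (ext b); lia.
have := @disjoint_card _ _ S [pred i | B i == b] (core b) 2 dS.
rewrite cc => leS; have {leS} : 2 * #|[pred i | B i == b]| <= (rk b).*2.+1.
  by apply: leS => i /dense; rewrite leqNgt extb.
by clear; lia.
Qed.

(** * What a block retains when a cycle is removed *)

Lemma rk_le_ext b : rk b <= ext b.
Proof. by case/orP: (good_rk b) => [/andP[/eqP->]|]; rewrite // gtn_max => /andP[_ /ltnW]. Qed.

Lemma card_rest (A C : {set block_graph}) (s : seq block_graph) :
  (forall z, z \in A -> z \in C -> z \in s) -> #|A| - size s <= #|A :\: C|.
Proof.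
move=> ACs; rewrite cardsD leq_sub2l //; apply: leq_trans (card_size s).
by apply/subset_leq_card/subsetP => z; rewrite inE => /andP[zA /(ACs _ zA)].
Qed.

(** The numerical conditions of [packs_triangles], with the core as dominating set: [rk b] triangles
    fit into the block without [C] and without the apex. *)
Definition survives b (C : {set block_graph}) : bool :=
  ((rk b).*2 <= #|core b :\: C|) && (3 * rk b <= #|block b :\: C|).

Lemma survives_disjoint b (C : {set block_graph}) : (forall z, z \in block b -> z \notin C) -> survives b C.
Proof.
move=> bC; apply/andP; split.
  apply: leq_trans (@card_rest _ _ [::] _).
    by rewrite card_core /core_size subn0 leqnSn.
  by move=> z /(subsetP (core_sub b)) /bC /negPf->.
apply: leq_trans (@card_rest _ _ [::] _); last by move=> z /bC /negPf->.
rewrite card_block /core_size subn0; have := rk_le_ext b.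
by move: (rk b) (ext b); lia.
Qed.

Definition hub b : bvertex :=
  Tagged (fun b => 'I_(core_size b + ext b)) (Ordinal (isT : 0 < core_size b + ext b)).

(** A shortest path from the apex to [x], with the apex left out. *)
Definition from_apex (x : bvertex) : seq block_graph :=
  if near_apex x then [:: Some x] else [:: Some (hub (tag x)); Some x].

Lemma from_apex_block x z : z \in from_apex x -> z \in block (tag x).
Proof.
rewrite /from_apex; case: ifP => _; rewrite !inE.
  by move/eqP->.
by case/orP => /eqP->.
Qed.

(** The path takes at most one core vertex, so [2r] of the [2r+1] remain. If it has two vertices,
    then [x] is far from the apex, so [i > r] and [2r+1+i-2 >= 3r]. *)
Lemma survives_from_apex x (C : {set block_graph}) :
  (forall z, z \in block (tag x) -> z \in C -> z \in from_apex x) ->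
  survives (tag x) C.
Proof.
move=> bC; set b := tag x in bC *.
have rl := rk_le_ext b; have := good_rk b.
have [nx|fx] := boolP (near_apex x).
  move=> _; have {}bC z : z \in block b -> z \in C -> z \in [:: Some x : block_graph].
    by move=> zb /(bC _ zb); rewrite /from_apex nx.
  apply/andP; split.
    apply: leq_trans (@card_rest _ _ [:: Some x : block_graph] _).
      by rewrite card_core /core_size subn1.
    by move=> z /(subsetP (core_sub b)); apply: bC.
  apply: leq_trans (@card_rest _ _ [:: Some x : block_graph] bC).
  rewrite card_block /core_size /=.
  by move: (rk b) (ext b) rl; clear; lia.
have [nc le1] : ~~ in_core x /\ 1 < ext b.
  by move: fx; rewrite negb_or -ltnNge => /andP.
rewrite leqNgt le1 andbF /= gtn_max => /andP[_ ltr].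
have {}bC z : z \in block b -> z \in C ->
    z \in [:: Some (hub b); Some x : block_graph].
  by move=> zb /(bC _ zb); rewrite /from_apex (negPf fx).
apply/andP; split.
  apply: leq_trans (@card_rest _ _ [:: Some (hub b) : block_graph] _).
    by rewrite card_core /core_size subn1.
  move=> z zc /(bC _ (subsetP (core_sub b) _ zc)).
  rewrite !inE => /orP[-> //|/eqP E]; move: zc.
  by rewrite E !inE (negPf nc) andbF.
apply: leq_trans (@card_rest _ _ _ bC).
rewrite card_block /core_size /=.
by move: (rk b) (ext b) ltr; clear; lia.
Qed.

Lemma packs_rest b (Y : {set block_graph}) :
  Y \subset None |: block b -> (rk b).*2 <= #|core b :&: Y| -> 3 * rk b <= #|Y| ->
  packs Y (rk b).
Proof.
(* Core vertices are adjacent to the apex and to all other vertices of their block, so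
   [core b :&: Y] dominates [Y]. *)
move=> /subsetP sY leQ leY; apply: packs_triangles leQ leY; first exact: subsetIr.
move=> q y; rewrite inE => /andP[qc _] /sY; case: q qc => [q|]; last by rewrite inE.
rewrite !inE => /andP[/eqP qb qc]; case: y => [y|] /=; last by rewrite /near_apex qc.
by rewrite qb qc eq_sym => -> nqy; rewrite /= andbT; apply: contraNneq nqy => ->.
Qed.

(** * Every new edge creates [k] disjoint cycles *)

(** The cycle [c] is the additional one; each block packs its rank in triangles off [c]. The block
    [b0] may use the apex, if [c] leaves it free. *)
Lemma add_edge_contains (u v : block_graph) (c : seq (add_edge u v)) b0 :
  uniq c -> is_cycle c ->
  (forall b, b != b0 -> survives b [set x in c]) ->
  (rk b0).*2 <= #|core b0 :\: [set x in c]| ->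
  3 * rk b0 <= #|(None |: block b0) :\: [set x in c]| ->
  contains_member (kcycles (\sum_b rk b).+1) (add_edge u v).
Proof.
move=> uc cc sb leQ leY; apply: (@packs_contains (add_edge u v) None).
pose C : {set block_graph} := [set x in c].
pose Y b : {set block_graph} := (if b == b0 then None |: block b else block b) :\: C.
have sY b : Y b \subset None |: block b.
  by rewrite /Y; case: ifP => _; apply: subset_trans (subsetDl _ _) _; rewrite ?subsetUr.
have dY b b' : b != b' -> [disjoint Y b & Y b'].
  move=> nbb; apply/pred0P => z /=; apply/negP; rewrite !inE => /andP[].
  have := block_disj nbb => /pred0P /(_ z) /= /negP db.
  move=> /andP[_ zb] /andP[_ zb']; apply: db.
  case: z zb zb' => [z|]; last first.
    case: ifP => [/eqP Eb|_]; case: ifP => [/eqP Eb'|_]; rewrite !inE //.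
    by rewrite Eb Eb' eqxx in nbb.
  by case: ifP; case: ifP; rewrite !inE /= => _ _ -> ->.
have pY b : @packs (add_edge u v) (Y b) (rk b).
  apply: packs_add_edge; apply: packs_rest => //.
    have [->|nb] := eqVneq b b0.
      apply: leq_trans leQ _; apply/subset_leq_card/subsetP => z.
      rewrite /Y eqxx; rewrite !inE => /andP[-> zc]; rewrite zc.
      by case: z zc => [z /andP[-> _]|] //; rewrite ?orbT.
    have /andP[lec _] := sb _ nb; apply: leq_trans lec _.
    apply/subset_leq_card/subsetP => z.
    rewrite /Y (negPf nb) !inE => /andP[-> zc]; rewrite zc.
    by case: z zc => [z /andP[-> _]|] //; rewrite ?orbT.
  rewrite /Y; have [->|nb] // := eqVneq b b0.
  by have /andP[] := sb _ nb.
rewrite -add1n; apply: (packs_sub (subsetT ([set x in c] :|: \bigcup_b Y b))).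
apply: packsU; [|exact: packs1|exact: packs_bigcup].
rewrite disjoint_sym disjoints_subset; apply/bigcupsP => b _.
apply/subsetP => z; rewrite /Y inE => /andP[]; by rewrite !inE.
Qed.

(** When all blocks survive without the apex, any block can serve as [b0]; the explicit index
    supplies one. *)
Lemma add_edge_survives (u v : block_graph) (c : seq (add_edge u v)) :
  'I_(size bl) -> uniq c -> is_cycle c -> (forall b, survives b [set x in c]) ->
  contains_member (kcycles (\sum_b rk b).+1) (add_edge u v).
Proof.
move=> b0 uc cc sb; have /andP[leQ leY] := sb b0.
apply: (@add_edge_contains _ _ c b0) => //; apply: leq_trans leY _.
exact/subset_leq_card/setSD/subsetUr.
Qed.

Lemma adj_add_edge (G : sgraph) (u v a b : G) : adj a b -> @adj (add_edge u v) a b.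
Proof. by rewrite /= /add_edge_rel => ->. Qed.

Lemma adj_apex_hub b : @adj block_graph None (Some (hub b)).
Proof. by []. Qed.

Lemma adj_hub x : x != hub (tag x) -> @adj block_graph (Some (hub (tag x))) (Some x).
Proof. by rewrite /= eqxx eq_sym => ->. Qed.

Lemma noncore_neq_hub x b : ~~ in_core x -> x != hub b.
Proof. by apply: contraNneq => ->. Qed.

Lemma far_not_core x : ~~ near_apex x -> ~~ in_core x.
Proof. by rewrite negb_or => /andP[]. Qed.

Lemma uniq_from_apex x : uniq (from_apex x).
Proof.
rewrite /from_apex; case: ifP => // /negbT /far_not_core /(noncore_neq_hub (tag x)) nxh.
by rewrite /= inE andbT eq_sym; apply: contraNneq nxh => -[->].
Qed.

(** The new edge closes a triangle on the apex, the hub and [y]. *)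
Lemma add_edge_apex (u v : block_graph) (y : bvertex) :
  ~~ near_apex y -> @adj (add_edge u v) None (Some y) ->
  contains_member (kcycles (\sum_b rk b).+1) (add_edge u v).
Proof.
move=> fy auv; have nyh := noncore_neq_hub (tag y) (far_not_core fy).
apply: (@add_edge_survives _ _ (None :: from_apex y)).
- exact: tag y.
- rewrite cons_uniq uniq_from_apex andbT.
  by apply/negP => /from_apex_block; rewrite inE.
- have a1 := adj_add_edge u v (adj_apex_hub (tag y)).
  have a2 := adj_add_edge u v (adj_hub nyh).
  rewrite adj_sym in auv; rewrite /is_cycle /from_apex (negPf fy).
  by move: (@adj (add_edge u v)) auv a1 a2 => e /= -> -> ->.
move=> b; have [<-|nb] := eqVneq (tag y) b.
  apply: survives_from_apex => -[z|]; first by rewrite !inE.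
  by rewrite [_ \in block _]inE.
apply: survives_disjoint => -[z|] zb; last by rewrite inE in zb.
rewrite !inE /=; apply/negP => /from_apex_block zy.
by have := disjointFr (block_disj nb) zy; rewrite zb.
Qed.

(** The cycle runs from the apex to [x], over the new edge to [y], and back; each of the two blocks
    loses just one path from the apex. *)
Lemma add_edge_across (x y : bvertex) : tag x != tag y ->
  contains_member (kcycles (\sum_b rk b).+1)
    (@add_edge block_graph (Some x) (Some y)).
Proof.
move=> nxy; have dxy := block_disj nxy.
set G' := add_edge _ _.
have axy : @adj G' (Some x) (Some y).
  rewrite /= /add_edge_rel !eqxx /= andbT.
  by apply/orP; right; apply: contraNneq nxy => -[->].
apply: (@add_edge_survives _ _ (None :: from_apex x ++ rev (from_apex y))).
- exact: tag x.
- rewrite cons_uniq cat_uniq rev_uniq !uniq_from_apex andbT /= mem_cat mem_rev.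
  apply/andP; split.
    by apply/negP => /orP[] /from_apex_block; rewrite inE.
  apply/hasPn => z; rewrite mem_rev => /from_apex_block zy.
  by apply/negP => /from_apex_block zx; have := disjointFr dxy zx; rewrite zy.
- have ah b : @adj G' None (Some (hub b)) by apply: adj_add_edge.
  have ah' b : @adj G' (Some (hub b)) None by rewrite adj_sym.
  have af z : ~~ near_apex z -> @adj G' (Some (hub (tag z))) (Some z).
    move=> fz; apply: adj_add_edge; apply: adj_hub.
    exact/noncore_neq_hub/far_not_core.
  have af' z : ~~ near_apex z -> @adj G' (Some z) (Some (hub (tag z))).
    by move=> fz; rewrite adj_sym; apply: af.
  have an z : near_apex z -> @adj G' None (Some z) by move=> nz; apply: adj_add_edge.
  have an' z : near_apex z -> @adj G' (Some z) None by move=> nz; rewrite adj_sym an.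
  rewrite /is_cycle /from_apex.
  move: (@adj G') axy ah ah' af af' an an' => e axy ah ah' af af' an an'.
  by case: ifP => nx; case: ifP => ny; rewrite /= axy ?ah ?ah' ?an ?an' ?af ?af' ?nx ?ny.
move=> b; have memc z : z \in block b ->
    z \in None :: from_apex x ++ rev (from_apex y) ->
    (z \in from_apex x) || (z \in from_apex y).
  by case: z => [z|]; rewrite !inE // mem_cat mem_rev.
have [xb|nxb] := eqVneq (tag x) b.
  rewrite -xb in memc *; apply: survives_from_apex => z zb; rewrite inE.
  move=> /(memc _ zb) /orP[//|/from_apex_block zy].
  by have := disjointFr dxy zb; rewrite zy.
have [yb|nyb] := eqVneq (tag y) b.
  rewrite -yb in memc *; apply: survives_from_apex => z zb; rewrite inE.
  move=> /(memc _ zb) /orP[/from_apex_block zx|//].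
  by have := disjointFr dxy zx; rewrite zb.
apply: survives_disjoint => z zb; rewrite inE; apply/negP => /(memc _ zb) /orP[].
  by move=> /from_apex_block /(disjointFr (block_disj nxb)); rewrite zb.
by move=> /from_apex_block /(disjointFr (block_disj nyb)); rewrite zb.
Qed.

(** The triangle on [x], [y] and the hub leaves the apex to the same block. With it, [2r+i-1 >= 3r]
    vertices remain, as [i > r]; without it, one is missing when [i = r+1]. *)
Lemma add_edge_inside (x y : bvertex) : tag x = tag y -> x != y ->
  ~~ in_core x -> ~~ in_core y ->
  contains_member (kcycles (\sum_b rk b).+1)
    (@add_edge block_graph (Some x) (Some y)).
Proof.
move=> txy nxy cx cy; have hx := noncore_neq_hub (tag x) cx; have hy := noncore_neq_hub (tag x) cy.
set b := tag x in txy hx hy *.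
(* Two distinct vertices off the core exclude the exceptional blocks, so that [rk b < ext b]. *)
have ext2 : 1 < ext b.
  have : [set Some x; Some y] \subset block b :\: core b.
    apply/subsetP => z; rewrite !inE => /orP[]/eqP->.
      by rewrite (negPf cx) andbF eqxx.
    by rewrite (negPf cy) andbF txy eqxx.
  move/subset_leq_card; rewrite cards2 cardsD (setIidPr (core_sub b)).
  rewrite card_block card_core addKn.
  suff -> : (Some x : block_graph) != Some y by [].
  by apply: contraNneq nxy => -[->].
have := good_rk b; rewrite leqNgt ext2 andbF /= gtn_max => /andP[_ ltr].
set G' := add_edge _ _; pose c : seq G' := [:: Some x; Some y; Some (hub b)].
have cE z : z \in [set t in c] -> z \in c by rewrite inE.
apply: (@add_edge_contains _ _ c b).
- rewrite /= !inE !negb_or /= andbT.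
  by rewrite ![Some _ == Some _]/(_ == _) nxy hx hy.
- have a1 : @adj G' (Some x) (Some y).
    rewrite /= /add_edge_rel !eqxx /= andbT.
    by apply/orP; right; apply: contraNneq nxy => -[->].
  have a2 : @adj G' (Some y) (Some (hub b)).
    by rewrite adj_sym; apply: adj_add_edge; rewrite txy; apply: adj_hub; rewrite -txy.
  have a3 : @adj G' (Some (hub b)) (Some x) by apply: adj_add_edge; apply: adj_hub.
  by rewrite /is_cycle /c; move: (@adj G') a1 a2 a3 => e /= -> -> ->.
- move=> b' nb; apply: survives_disjoint => z zb.
  have : z \in c -> z \in block b.
    by rewrite !inE => /or3P[]/eqP-> /=; rewrite -?txy.
  move=> cb; apply/negP => /cE /cb zb'.
  by have := disjointFr (block_disj nb) zb; rewrite zb'.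
- apply: leq_trans (@card_rest _ _ [:: Some (hub b) : block_graph] _).
    by rewrite card_core /core_size subn1.
  move=> z zc /cE; rewrite !inE => /or3P[/eqP E|/eqP E|-> //]; move: zc.
    by rewrite E !inE (negPf cx) andbF.
  by rewrite E !inE (negPf cy) andbF.
apply: leq_trans (@card_rest _ _ c (fun z _ => @cE z)).
rewrite cardsU1 card_block inE /core_size /=.
by move: (rk b) (ext b) ltr; clear; lia.
Qed.

Lemma block_graph_saturated :
  saturated (kcycles (\sum_b rk b).+1) block_graph.
Proof.
split; first exact: block_graph_free.
move=> [x|] [y|] //= nxy.
- have [txy|ntxy] := eqVneq (tag x) (tag y); last by move=> _; apply: add_edge_across.
  have {}nxy : x != y by apply: contraNneq nxy => ->.
  by rewrite nxy negb_or /= => /andP[ncx ncy]; apply: add_edge_inside.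
- by move=> fx; apply: add_edge_apex fx _; rewrite /= /add_edge_rel !eqxx orbT.
- by move=> fx; apply: add_edge_apex fx _; rewrite /= /add_edge_rel !eqxx orbT.
Qed.

End BlockGraph.

(** * Numbers of vertices and edges *)

Lemma handshake (G : sgraph) : \sum_(x : G) #|[set y | adj x y]| = #|edges G|.*2.
Proof.
rewrite -muln2 -sum_nat_const.
transitivity (\sum_(p : G * G | adj p.1 p.2) 1).
  under eq_bigr => x _ do rewrite cardsE -sum1_card.
  by rewrite pair_big_dep /=.
rewrite (partition_big (fun p : G * G => [set p.1; p.2]) (mem (edges G))) /=; last first.
  by move=> p adjp; apply/imsetP; exists p; rewrite ?inE.
apply: eq_bigr => e /imsetP[[a b]]; rewrite inE /= => ab ->{e}.
have nab : a != b by apply: contraTneq ab => ->; rewrite adj_irr.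
(* The edge with ends [a] and [b] comes from exactly two ordered pairs. *)
rewrite sum1_card (_ : 2 = #|[set (a, b); (b, a)]|); last first.
  rewrite cards2; suff -> : (a, b) != (b, a) by [].
  by apply: contraNneq nab => -[->].
apply: eq_card => -[c d]; rewrite !inE -topredE /=.
apply/andP/orP => [[cd /eqP/setP E]|[]/eqP[-> ->]]; last 2 first.
- by rewrite ab.
- by rewrite adj_sym ab setUC.
have ncd : c != d by apply: contraTneq cd => ->; rewrite adj_irr.
have : (c == a) || (c == b) by have := E c; rewrite !inE eqxx => <-.
have : (d == a) || (d == b) by have := E d; rewrite !inE eqxx orbT => <-.
move: ncd => /[swap] /orP[]/eqP-> /[swap] /orP[]/eqP->; rewrite ?eqxx // => _.
  by right.
by left.
Qed.

Lemma sum_option (T : finType) (F : option T -> nat) :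
  \sum_x F x = F None + \sum_x F (Some x).
Proof.
rewrite (bigD1 None) //=; congr (_ + _).
rewrite (reindex_omap Some id) //=; first by apply: eq_bigl => x; rewrite eqxx.
by case.
Qed.

Section BlockGraphSize.
Variable bl : seq (nat * nat).
Local Notation G := (block_graph bl).

Lemma sum_bvertex (F : 'I_(size bl) -> bool -> nat) :
  \sum_(x : bvertex bl) F (tag x) (in_core x) =
  \sum_b (core_size b * F b true + ext b * F b false).
Proof.
transitivity (\sum_b \sum_(j < core_size b + ext b) F b (j < core_size b)).
  by rewrite sig_big_dep /=; apply: eq_bigr => -[].
apply: eq_bigr => b _; rewrite big_split_ord /=; congr (_ + _).
  under eq_bigr => j _ do rewrite ltn_ord.
  by rewrite sum_nat_const card_ord.
under eq_bigr => j _ do rewrite ltnNge leq_addr.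
by rewrite sum_nat_const card_ord.
Qed.

Lemma card_block_graph :
  #|G| = (\sum_(p <- bl) (p.1.*2.+1 + p.2)).+1.
Proof.
rewrite [#|G|]card_option -sum1_card (sum_bvertex (fun _ _ => 1)).
congr _.+1; rewrite (big_nth (0, 0)) big_mkord.
by apply: eq_bigr => b _; rewrite !muln1.
Qed.

(** A block has [r(2r+1)] edges inside its core, [(2r+1)i] from the core to the rest and [2r+1] from
    the core to the apex, in all [(2r+1)(r+i+1)]; for [i <= 1] the apex has [i] more. *)
Lemma card_edges_block_graph :
  #|edges G| = \sum_(p <- bl) (p.1.*2.+1 * (p.1 + p.2).+1 + (p.2 <= 1) * p.2).
Proof.
apply: double_inj; rewrite -handshake sum_option.
have -> : #|[set y | @adj G None y]| =
    \sum_(b < size bl) (core_size b * true + ext b * (ext b <= 1)).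
  rewrite -(sum_bvertex (fun b c => c || (ext b <= 1))) -sum1_card.
  rewrite big_mkcond sum_option inE /= add0n; apply: eq_bigr => x _.
  by rewrite inE.
(* For the degree of a core vertex, the apex makes up for the vertex itself. *)
have -> : \sum_(x : bvertex bl) #|[set y | @adj G (Some x) y]| =
    \sum_(b < size bl) (core_size b * (core_size b + ext b)
            + ext b * (core_size b + (ext b <= 1))).
  rewrite -(sum_bvertex (fun b c =>
    if c then core_size b + ext b else core_size b + (ext b <= 1))).
  apply: eq_bigr => x _.
  have -> : [set y | @adj G (Some x) y] =
      (if near_apex x then [set None] else set0) :|:
      (if in_core x then block (tag x) :\ Some x else core (tag x)).
    apply/setP => -[y|]; rewrite !inE /=; last first.
      by rewrite /near_apex; case: ifP; case: ifP; rewrite !inE.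
    rewrite [tag x == _]eq_sym [x == y]eq_sym.
    have [->|nyx] := eqVneq y x.
      by case: ifP => _; case: ifP => cx; rewrite !inE ?cx ?eqxx ?andbF.
    have {}nyx : (Some y : G) != Some x by apply: contraNneq nyx => -[->].
    by case: ifP => _; case: ifP => cx; rewrite !inE ?nyx /= ?andbT.
  have cN (A : {set G}) : None \notin A ->
      #|(if near_apex x then [set None] else set0) :|: A| = near_apex x + #|A|.
    by case: ifP => _ nA; rewrite ?set0U // cardsU1 nA.
  rewrite cN; last by case: ifP; rewrite !inE.
  rewrite /near_apex; case: ifP => cx /=; last by rewrite card_core addnC.
  by rewrite -card_block (cardsD1 (Some x : G) (block _)) inE eqxx.
rewrite -big_split (big_nth (0, 0)) big_mkord -[RHS]mul2n big_distrr /=.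
apply: eq_bigr => b _; rewrite /core_size -/(rk b) -/(ext b).
by case: (_ <= 1); move: (rk b) (ext b); nia.
Qed.

End BlockGraphSize.

(** * Choosing blocks for a given number of edges *)

Definition rank_sum (bl : seq (nat * nat)) : nat := \sum_(p <- bl) p.1.
(** The apex is not counted here. *)
Definition size_sum (bl : seq (nat * nat)) : nat := \sum_(p <- bl) (p.1.*2.+1 + p.2).
Definition edge_sum (bl : seq (nat * nat)) : nat :=
  \sum_(p <- bl) (p.1.*2.+1 * (p.1 + p.2).+1 + (p.2 <= 1) * p.2).

Lemma ES_blocks bl : all good_block bl ->
  ES (size_sum bl).+1 (kcycles (rank_sum bl).+1) (edge_sum bl).
Proof.
move=> good; exists (block_graph bl); split.
- exact: card_block_graph.
- rewrite /rank_sum (big_nth (0, 0)) big_mkord; exact: block_graph_saturated.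
- exact: card_edges_block_graph.
Qed.

(** Each [(1, 1)] adds 4 vertices, 10 edges and rank 1; each [(0, 0)] adds one vertex and one edge.
    Thus [p] adjusts the number of cycles, and [l] adjusts [n] without changing the excess over
    [n-1]. *)
Lemma ES_blocks_fill bl p l : all good_block bl ->
  ES (1 + size_sum bl + 4 * p + l) (kcycles (1 + rank_sum bl + p))
     (edge_sum bl + 10 * p + l).
Proof.
move=> good; pose bl' := bl ++ nseq p (1, 1) ++ nseq l (0, 0).
have -> : 1 + size_sum bl + 4 * p + l = (size_sum bl').+1.
  by rewrite /size_sum !big_cat !big_nseq !iter_addn_0 /=; lia.
have -> : 1 + rank_sum bl + p = (rank_sum bl').+1.
  by rewrite /rank_sum !big_cat !big_nseq !iter_addn_0 /=; lia.
have -> : edge_sum bl + 10 * p + l = edge_sum bl'.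
  by rewrite /edge_sum !big_cat !big_nseq !iter_addn_0 /=; lia.
by apply: ES_blocks; rewrite !all_cat good !all_nseq /= !orbT.
Qed.

(** The excess of [(1, i)], [i >= 2], is [2i+3]. So [12 = 6+6], odd [T] is [6+(2i+3)] and even [T]
    is [7+(2i+3)]. The last conclusion serves to fit these blocks into [n] vertices. *)
Lemma fine_blocks T : 12 <= T -> exists bl,
  [/\ all good_block bl, rank_sum bl = 2, edge_sum bl = size_sum bl + T
    & (size_sum bl).*2 <= T + 6].
Proof.
rewrite leq_eqVlt => /orP[/eqP<-|lt12].
  by exists [:: (1, 1); (1, 1)]; rewrite /rank_sum /edge_sum /size_sum !big_cons !big_nil.
have [oT|eT] := boolP (odd T).
  exists [:: (1, 1); (1, (T - 9)./2)].
  rewrite /rank_sum /edge_sum /size_sum !big_cons !big_nil /good_block /=.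
  have [i Ei] : exists i, T = i.+2.*2 + 9.
    by exists ((T - 13)./2); move: oT lt12; lia.
  have -> : (T - 9)./2 = i.+2 by lia.
  by rewrite Ei; split=> //; lia.
exists [:: (1, 2); (1, (T - 10)./2)].
rewrite /rank_sum /edge_sum /size_sum !big_cons !big_nil /good_block /=.
have [i Ei] : exists i, T = i.+2.*2 + 10.
  by exists ((T - 14)./2); move: eT lt12; lia.
have -> : (T - 10)./2 = i.+2 by lia.
by rewrite Ei; split=> //; lia.
Qed.

(** Here [r = k-3]: [r] copies of [(1, 1)] have excess [6r], and two fine blocks provide the
    remaining [e-6r >= 12]. *)
Lemma ES_small r n e : 2 <= r -> 4 * r ^ 2 + 3 * r + 10 <= n ->
  6 * r + 12 <= e -> e < 4 * r ^ 2 + 3 * r + 12 ->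
  ES n (kcycles (r + 3)) (n - 1 + e).
Proof.
move=> r2 ln le12 ltE.
have [|bl [good rbl ebl sbl]] := @fine_blocks (e - 6 * r); first by lia.
have := @ES_blocks_fill bl r (n - 1 - size_sum bl - 4 * r) good.
rewrite rbl ebl; move: (size_sum bl) sbl => s sbl.
have ls : 1 + s + 4 * r <= n by nia.
by congr (ES _ (kcycles _) _); lia.
Qed.

(** A block [(r, i)] has excess [2r^2+r+2ri]. Dividing what is left of [e] beyond [2r^2+r+12] by
    [2r] gives [i] as quotient, and the remainder [t] goes to two fine blocks of excess [12+t]. *)
Lemma ES_large r n e : 2 <= r ->
  4 * r ^ 2 + 3 * r + 12 <= e -> e + 6 * r ^ 2 + 15 * r <= 2 * r * n + 7 ->
  ES n (kcycles (r + 3)) (n - 1 + e).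
Proof.
move=> r2 leE ltE; pose d := e - (2 * r ^ 2 + r + 12).
have Ed : e = 2 * r ^ 2 + r + 12 + d by rewrite /d; nia.
have := divn_eq d (2 * r); have := @ltn_pmod d (2 * r).
set i := d %/ _; set t := d %% _ => lt_t Ei.
have {}lt_t : t < 2 * r by apply: lt_t; lia.
(* The lower bound on [e] is [12] plus the excess [4r^2+3r] of [(r, r+1)]. *)
have ri : r < i by nia.
have [|bl [good rbl ebl sbl]] := @fine_blocks (12 + t); first by lia.
have gi : good_block (r, i) by rewrite /good_block /= gtn_max ri andbT; apply/orP; right; lia.
(* The upper bound on [e] bounds [i], so the blocks fit; pendant edges fill up the rest. *)
have [l En] : exists l, n = size_sum bl + 2 * r + 2 + i + l.
  exists (n - (size_sum bl + 2 * r + 2 + i)).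
  by move: (size_sum bl) sbl => s sbl; nia.
have := @ES_blocks_fill ((r, i) :: bl) 0 l.
rewrite /rank_sum /edge_sum /size_sum !big_cons -/(rank_sum _) -/(edge_sum _) -/(size_sum _).
rewrite rbl ebl /= good gi => /(_ isT); have -> : (i <= 1) = false by lia.
move: (size_sum bl) En => s En.
have -> : 1 + (r.*2.+1 + i + s) + 4 * 0 + l = n by clear -En; lia.
have -> : 1 + (r + 2) + 0 = r + 3 by clear; lia.
suff -> : r.*2.+1 * (r + i).+1 + false * i + (s + (12 + t)) + 10 * 0 + l = n - 1 + e by [].
by rewrite mul0n muln0 !addn0 En Ed Ei; clear; lia.
Qed.

(** Descent to the least edge number; membership in [ES] is decided classically. *)
Lemma ES_is_sat n (F : graph_family) m :
  ES n F m -> exists2 s, is_sat n F s & s <= m.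
Proof.
elim/ltn_ind: m => m IHm ESm.
have [[m' ltm ESm']|nom] := classic (exists2 m', m' < m & ES n F m').
  by have [s sat_s les] := IHm _ ltm ESm'; exists s => //; apply: leq_trans les (ltnW _).
exists m => //; split=> // m' ESm'; rewrite leqNgt; apply/negP => ltm.
by apply: nom; exists m'.
Qed.

Theorem theorem1p5 :
  (forall k n : nat,
     3 <= k ->
     (4 * k%:Z - 3 <= n%:Z)%R ->
     exists2 s : nat,
       is_sat n (kcycles k) s & (s%:Z <= n%:Z + 6 * k%:Z - 7)%R) /\
  (forall k n : nat,
     5 <= k ->
     (4 * k%:Z ^+ 2 - 21 * k%:Z + 37 <= n%:Z)%R ->
     forall m : nat,
       (n%:Z + 6 * k%:Z - 7 <= m%:Z
          <= (2 * k%:Z - 5) * n%:Z - 6 * k%:Z ^+ 2 + 21 * k%:Z - 3)%R ->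
       ES n (kcycles k) m).
Proof.
split=> [k n k3 kn|k n k5 kn m /andP[lem mle]].
  (* Take [k-1] copies of [K_5] at the apex, on [4k-3] vertices, and pendant edges: [n-1+6(k-1)]
     edges. *)
  have := @ES_blocks_fill [::] (k - 1) (n + 3 - 4 * k) isT.
  rewrite /rank_sum /size_sum /edge_sum !big_nil.
  have -> : 1 + 0 + 4 * (k - 1) + (n + 3 - 4 * k) = n by lia.
  have -> : 1 + 0 + (k - 1) = k by lia.
  move=> /ES_is_sat [s sat_s les]; exists s => //.
  by lia.
(* In terms of [r = k-3] and the excess [e] over [n-1], the interval becomes
   [6r+12 <= e <= 2rn-6r^2-15r+7]. *)
have [r Ek] : exists r, k = r + 3 by exists (k - 3); lia.
have [e Em] : exists e, m = n - 1 + e.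
  by exists (m - (n - 1)); lia.
rewrite {}Ek {}Em in k5 kn lem mle *.
have r2 : 2 <= r by lia.
have n0 : 0 < n by nia.
have ln : 4 * r ^ 2 + 3 * r + 10 <= n by nia.
have le12 : 6 * r + 12 <= e by lia.
(* The threshold is the least excess reached by a large block together with two fine ones. *)
have [ltE|leE] := ltnP e (4 * r ^ 2 + 3 * r + 12); first exact: ES_small.
by apply: ES_large => //; nia.
Qed.
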